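(* Let $G$ be a finite group, let $*$ be a nonidentical involutory antiautomorphism of $G$ with $gg^*\in Z(G)$ for every $g\in G$, and let $g_0\in Z(G)$ with $g_0^*=g_0$. Let $\beta\in\{xy,\,x^*y,\,yx,\,yx^*\}$, $\gamma\in\{xy,\,yx\}$ and $\delta\in\{g_0xy,\,g_0xy^*,\,g_0x^*y,\,g_0x^*y^*,\,g_0yx,\,g_0yx^*,\,g_0y^*x,\,g_0y^*x^*\}$. Then the loop $L=Q(G,*,g_0,\beta,\gamma,\delta)$ is flexible if and only if at least one of the following holds: (a) $L$ is Moufang; (b) $(\beta,\gamma,\delta)$ is among $(xy,xy,g_0y^*x^* )$, $(x^*y,yx,g_0xy^* )$, $(x^*y,yx,g_0x^*y)$, $(x^*y,yx,g_0y^*x)$, $(yx,yx,g_0x^*y^* )$, $(yx,yx,g_0yx)$, $(yx^*,xy,g_0xy^* )$, $(yx^*,xy,g_0x^*y)$, $(yx^*,xy,g_0yx^* )$, $(yx^*,xy,g_0y^*x)$; (c) $G/Z(G)$ is an elementary abelian $2$-group and $(\beta,\gamma,\delta)$ is among $(xy,xy,g_0x^*y^* )$, $(xy,xy,g_0yx)$, $(yx,yx,g_0xy)$, $(yx,yx,g_0y^*x^* )$.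
   Context: $Z(G)$ is the center of $G$. An involutory antiautomorphism $*$ of $G$ satisfies $(g^* )^*=g$ and $(gh)^*=h^*g^*$; nonidentical means $g^*\neq g$ for some $g\in G$. A word such as $yx^*$ or $g_0y^*x$ denotes the function $G\times G\to G$ sending $(x,y)$ to the value of the word. Words are regarded as functions: two words are identified when they define the same function on $G\times G$ (for instance $xy$ and $yx$ when $G$ is commutative), and equality of triples $(\beta,\gamma,\delta)$ means equality of the three functions. Let $Gu=\{gu : g\in G\}$ be a disjoint copy of $G$. The loop $Q(G,*,g_0,\beta,\gamma,\delta)$ is the set $G\cup Gu$ with the multiplication, for $x,y\in G$, $$x\circ y=xy,\quad x\circ yu=\beta(x,y)u,\quad xu\circ y=\gamma(x,y)u,\quad xu\circ yu=\delta(x,y).$$ It is a loop with neutral element $1\in G$. The trivial group counts as an elementary abelian $2$-group. A loop is flexible if it satisfies $x(yx)=(xy)x$, and Moufang if it satisfies $x(y(xz))=((xy)x)z$. *)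

(* Defs.v *)
From mathcomp Require Import all_boot all_fingroup all_solvable.

Set Implicit Arguments.
Unset Strict Implicit.
Unset Printing Implicit Defensive.

Import GroupScope.

Definition is_loop (T : Type) (op : T -> T -> T) (e : T) : Prop :=
  [/\ left_id e op, right_id e op,
      forall a b, exists! x, op a x = b
    & forall a b, exists! y, op y a = b].

Definition flexible (T : Type) (op : T -> T -> T) : Prop :=
  forall x y, op x (op y x) = op (op x y) x.

Definition Moufang (T : Type) (op : T -> T -> T) : Prop :=
  forall x y z, op x (op y (op x z)) = op (op (op x y) x) z.

Definition involutory_antiaut (gT : finGroupType) (star : gT -> gT) : Prop :=
  involutive star /\ forall g h, star (g * h) = star h * star g.

(* Finite functions, so that Leibniz equality (and hence membership in a list)
   identifies two words exactly when they take the same values on G x G. *)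
Definition word (gT : finGroupType) (f : gT -> gT -> gT) :
    {ffun gT * gT -> gT} :=
  [ffun p => f p.1 p.2].

Definition beta_words (gT : finGroupType) (star : gT -> gT) :=
  [:: word (fun x y : gT => x * y); word (fun x y => star x * y);
      word (fun x y => y * x); word (fun x y => y * star x)].

Definition gamma_words (gT : finGroupType) :=
  [:: word (fun x y : gT => x * y); word (fun x y => y * x)].

Definition delta_words (gT : finGroupType) (star : gT -> gT) (g0 : gT) :=
  [:: word (fun x y => g0 * x * y); word (fun x y => g0 * x * star y);
      word (fun x y => g0 * star x * y); word (fun x y => g0 * star x * star y);
      word (fun x y => g0 * y * x); word (fun x y => g0 * y * star x);
      word (fun x y => g0 * star y * x); word (fun x y => g0 * star y * star x)].

(* The carrier of Q(G,*,g0,beta,gamma,delta) is the disjoint union gT + gT, with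
   inl g standing for g and inr g for gu; * and g0 enter only through the
   words. *)
Definition Qmul (gT : finGroupType) (beta gamma delta : {ffun gT * gT -> gT})
    (a b : gT + gT) : gT + gT :=
  match a, b with
  | inl x, inl y => inl (x * y)
  | inl x, inr y => inr (beta (x, y))
  | inr x, inl y => inr (gamma (x, y))
  | inr x, inr y => inl (delta (x, y))
  end.

Lemma Qmul_loop (gT : finGroupType) (star : gT -> gT) (g0 : gT)
    (beta gamma delta : {ffun gT * gT -> gT}) :
  involutory_antiaut star ->
  beta \in beta_words star -> gamma \in gamma_words gT ->
  delta \in delta_words star g0 ->
  is_loop (Qmul beta gamma delta) (inl 1).
Proof.
move=> [sK sM] Hb Hc Hd.
have s1 : star 1 = 1.
  by apply: (mulgI (star 1)); rewrite -sM !mulg1.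
have inj_s := inv_inj sK.
have [bl br b1] : [/\ forall x, injective (fun y => beta (x, y)),
    forall y, injective (fun x => beta (x, y)) & forall y, beta (1, y) = y].
  by move: Hb; rewrite !inE => /or4P[] /eqP->; split=> [x y z|x y z|y];
    rewrite !ffunE /= ?s1 ?mul1g ?mulg1 // => H;
    do ?[move/mulgI: H => H | move/mulIg: H => H | move/inj_s: H => H].
have [cl cr c1] : [/\ forall x, injective (fun y => gamma (x, y)),
    forall y, injective (fun x => gamma (x, y)) & forall x, gamma (x, 1) = x].
  by move: Hc; rewrite !inE => /orP[] /eqP->; split=> [x y z|x y z|y];
    rewrite !ffunE /= ?mul1g ?mulg1 // => H;
    do ?[move/mulgI: H => H | move/mulIg: H => H].
have [dl dr] : (forall x, injective (fun y => delta (x, y))) /\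
    (forall y, injective (fun x => delta (x, y))).
  by move: Hd; rewrite !inE; repeat case/orP; move/eqP->;
    split=> x y z; rewrite !ffunE /= -!mulgA => /mulgI H;
    do ?[move/mulgI: H => H | move/mulIg: H => H | move/inj_s: H => H].
have solve (f : gT + gT -> gT + gT) : injective f ->
    forall b, exists! x, f x = b.
  move=> fI b; have [g fK gK] := injF_bij fI.
  by exists (g b); split=> [|x <-]; rewrite ?gK ?fK.
split.
- by case=> y /=; rewrite ?mul1g ?b1.
- by case=> y /=; rewrite ?mulg1 ?c1.
- move=> a; apply: solve; case: a => a [x|x] [y|y] //= [] H; congr (_ _).
  + exact: mulgI H.
  + exact: bl H.
  + exact: cl H.
  + exact: dl H.
- move=> a; apply: (solve (fun y => Qmul _ _ _ y a)).
  case: a => a [x|x] [y|y] //= [] H; congr (_ _).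
  + exact: mulIg H.
  + exact: cr H.
  + exact: br H.
  + exact: dr H.
Qed.

(* Main.v *)
(* Write x' for the image of x under the antiautomorphism.  Of the three
   identities on G that express flexibility of Q, the one for the pair (xu, y),
   delta(x, beta(y, x)) = delta(gamma(x, y), x), decides the forward direction.
   At x = 1 it shows, as y' = y fails for some y, that beta carries a prime
   exactly when delta carries exactly one.  Each of the 32 remaining triples is
   in (b), or is one of the two Moufang triples (xy, xy, g0xy) and
   (x'y, yx, g0yx'), or the identity cancels to the centrality of all squares
   (case (c)) or to commutativity of G; and over a commutative G all triples
   satisfying the condition on primes are in (b).  Conversely, x x' = x' x is
   central, so the words can be normalised by collecting the products x x'. *)

Require Import Defs.
From mathcomp Require Import all_boot all_fingroup all_solvable.

Set Implicit Arguments.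
Unset Strict Implicit.
Unset Printing Implicit Defensive.

Import GroupScope.

Lemma Moufang_flexible (T : Type) (op : T -> T -> T) (e : T) :
  right_id e op -> Moufang op -> flexible op.
Proof. by move=> ope M x y; have := M x y e; rewrite !ope. Qed.

(** For two elements of G the law is associativity; each of the other three choices of cosets
    contributes one identity. *)
Lemma flexible_QmulP (gT : finGroupType)
    (beta gamma delta : {ffun gT * gT -> gT}) :
  flexible (Qmul beta gamma delta) <->
  [/\ forall x y, beta (x, gamma (y, x)) = gamma (beta (x, y), x),
      forall x y, delta (x, beta (y, x)) = delta (gamma (x, y), x)
    & forall x y, gamma (x, delta (y, x)) = beta (delta (x, y), x)].
Proof.
split=> [F | [F1 F2 F3] [x|x] [y|y] /=].
- split=> x y; first by have [] := F (inl x) (inr y).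
  + by have [] := F (inr x) (inl y).
  + by have [] := F (inr x) (inr y).
- by rewrite mulgA.
- by rewrite F1.
- by rewrite F2.
- by rewrite F3.
Qed.

Lemma mem_center (gT : finGroupType) (z : gT) :
  z \in 'Z([set: gT]) <-> forall x, z * x = x * z.
Proof.
split=> [/centerP[_ cz] x | cz]; first by apply: cz; rewrite inE.
by apply/centerP; split=> [|x _]; [rewrite inE | apply: cz].
Qed.

(** A group in which every square is trivial is abelian, so only the squares of G need to be tested
    against the center. *)
Lemma abelem2_quotient_center (gT : finGroupType) :
  2.-abelem ([set: gT] / 'Z([set: gT])) <->
  forall x y : gT, x * x * y = y * (x * x).
Proof.
have nZ (x : gT) : x \in 'N('Z([set: gT])).
  by apply: (subsetP (normal_norm (center_normal _))); rewrite inE.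
split=> [/(abelemP (isT : prime 2))[_ E] x | E].
  apply/mem_center/coset_idr; first exact: nZ.
  by rewrite (morphX _ 2) ?nZ //= E // mem_quotient ?inE.
apply: exponent2_abelem; apply/exponentP=> _ /morphimP[x _ _ ->].
by rewrite -morphX ?nZ //= coset_id // expgS expg1; apply/mem_center/E.
Qed.

Section StarredGroup.

Variables (gT : finGroupType) (star : gT -> gT) (g0 : gT).
Hypothesis star_anti : involutory_antiaut star.
Hypothesis star_central : forall g, g * star g \in 'Z([set: gT]).
Hypothesis g0_central : g0 \in 'Z([set: gT]).
Hypothesis g0_star : star g0 = g0.

Let starK : involutive star. Proof. by case: star_anti. Qed.

Let starM g h : star (g * h) = star h * star g. Proof. by case: star_anti. Qed.

Let star1 : star 1 = 1.
Proof. by apply: (mulgI (star 1)); rewrite -starM !mulg1. Qed.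

Let g0C x : x * g0 = g0 * x.
Proof. by move/mem_center: g0_central. Qed.

Let g0CA x z : x * (g0 * z) = g0 * (x * z).
Proof. by rewrite mulgA g0C -mulgA. Qed.

Lemma star_norm_central x y : x * star x * y = y * (x * star x).
Proof. by have /mem_center := star_central x. Qed.

(** Centrality of x x' gives x(x'x) = (x x')x = x(x x'), and x cancels. *)
Lemma star_commutes x : star x * x = x * star x.
Proof. by apply: (mulgI x); rewrite mulgA star_norm_central. Qed.

Local Notation words := {ffun gT * gT -> gT}.

Definition unconditional_triples : seq (words * words * words) :=
  [:: (word (fun x y => x * y), word (fun x y => x * y),
       word (fun x y => g0 * star y * star x));
      (word (fun x y => star x * y), word (fun x y => y * x),
       word (fun x y => g0 * x * star y));
      (word (fun x y => star x * y), word (fun x y => y * x),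
       word (fun x y => g0 * star x * y));
      (word (fun x y => star x * y), word (fun x y => y * x),
       word (fun x y => g0 * star y * x));
      (word (fun x y => y * x), word (fun x y => y * x),
       word (fun x y => g0 * star x * star y));
      (word (fun x y => y * x), word (fun x y => y * x),
       word (fun x y => g0 * y * x));
      (word (fun x y => y * star x), word (fun x y => x * y),
       word (fun x y => g0 * x * star y));
      (word (fun x y => y * star x), word (fun x y => x * y),
       word (fun x y => g0 * star x * y));
      (word (fun x y => y * star x), word (fun x y => x * y),
       word (fun x y => g0 * y * star x));
      (word (fun x y => y * star x), word (fun x y => x * y),
       word (fun x y => g0 * star y * x))].

Definition conditional_triples : seq (words * words * words) :=
  [:: (word (fun x y => x * y), word (fun x y => x * y),
       word (fun x y => g0 * star x * star y));
      (word (fun x y => x * y), word (fun x y => x * y),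
       word (fun x y => g0 * y * x));
      (word (fun x y => y * x), word (fun x y => y * x),
       word (fun x y => g0 * x * y));
      (word (fun x y => y * x), word (fun x y => y * x),
       word (fun x y => g0 * star y * star x))].

(** Hiding x x' behind an opaque c keeps later rewriting from splitting it again; the last two
    clauses reach a norm inside a right-associated word. *)
Lemma star_norm x : exists2 c, forall y, y * c = c * y &
  [/\ x * star x = c, star x * x = c,
      forall y, x * (star x * y) = c * y & forall y, star x * (x * y) = c * y].
Proof.
exists (x * star x) => [y|]; first by rewrite star_norm_central.
by split=> [||y|y]; rewrite ?star_commutes // mulgA ?star_commutes.
Qed.

Lemma unconditional_flexible beta gamma delta :
  (beta, gamma, delta) \in unconditional_triples ->
  flexible (Qmul beta gamma delta).
Proof.
rewrite !inE; do ?case/orP; case/eqP=> -> -> ->;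
  apply/flexible_QmulP; split=> x y; rewrite !ffunE /=.
all: have [c cC [n1 n2 n3 n4]] := star_norm x.
all: have cCA v w : v * (c * w) = c * (v * w) by rewrite mulgA cC mulgA.
all: rewrite ?starM ?starK ?g0_star -?mulgA.
all: by rewrite ?(g0CA, g0C) ?(n1, n2, n3, n4) ?(cCA, cC).
Qed.

Lemma conditional_flexible beta gamma delta :
  (forall x y : gT, x * x * y = y * (x * x)) ->
  (beta, gamma, delta) \in conditional_triples ->
  flexible (Qmul beta gamma delta).
Proof.
move=> sqC; rewrite !inE; do ?case/orP; case/eqP=> -> -> ->;
  apply/flexible_QmulP; split=> x y; rewrite !ffunE /=.
all: have sq (v w : gT) : w * (v * v) = v * (v * w) by rewrite -sqC mulgA.
(* Multiplied by x on the right, both sides become c x y': on the left x'x = c, on the right the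
   central square x x moves past y' and x'x = c again. *)
all: have star_flip : x * (star y * star x) = star x * (star y * x).
all: try by apply: (mulIg x); have [c cC [_ n2 _ _]] := star_norm x;
  rewrite -!mulgA sq n2 !mulgA cC n2 mulgA.
all: rewrite ?starM ?starK ?g0_star -?mulgA.
all: by rewrite ?(g0CA, g0C) ?star_flip ?sq.
Qed.

(** Here Q is a group: G with a central element u adjoined such that u u = g0. *)
Lemma group_triple_Moufang :
  Moufang (Qmul (word (fun x y : gT => x * y)) (word (fun x y => x * y))
    (word (fun x y => g0 * x * y))).
Proof.
case=> x [] y [] z /=; rewrite ?ffunE /= -?mulgA //.
all: by rewrite ?g0CA.
Qed.

(** These are the Cayley-Dickson product rules with parameter g0; the central x x' takes the place
    of the scalar norm. *)
Lemma starred_triple_Moufang :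
  Moufang (Qmul (word (fun x y : gT => star x * y)) (word (fun x y => y * x))
    (word (fun x y => g0 * y * star x))).
Proof.
case=> x [] y [] z /=; rewrite ?ffunE /= ?starM ?starK ?g0_star -?mulgA;
  have [c cC [n1 n2 n3 n4]] := star_norm x;
  have cCA v w : v * (c * w) = c * (v * w) by rewrite mulgA cC mulgA.
all: by rewrite ?(g0CA, g0C) ?(n1, n2, n3, n4) ?(cCA, cC).
Qed.

Lemma commutative_words :
    (forall x y : gT, x * y = y * x) ->
  [/\ word (fun x y : gT => y * x) = word (fun x y => x * y),
      word (fun x y => y * star x) = word (fun x y => star x * y) &
  [/\ word (fun x y => g0 * x * y) = word (fun x y => g0 * y * x),
      word (fun x y => g0 * x * star y) = word (fun x y => g0 * star y * x),
      word (fun x y => g0 * star x * y) = word (fun x y => g0 * y * star x) &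
      word (fun x y => g0 * star x * star y) =
      word (fun x y => g0 * star y * star x)]].
Proof.
move=> C; have C0 x y : g0 * x * y = g0 * y * x by rewrite -!mulgA (C x).
by split; last split; apply/ffunP=> -[x y]; rewrite !ffunE /=;
  first [exact: C | exact: C0].
Qed.

Lemma flexible_triples (beta gamma delta : words) :
    (exists g, star g <> g) ->
    beta \in beta_words star -> gamma \in gamma_words gT ->
    delta \in delta_words star g0 -> flexible (Qmul beta gamma delta) ->
  [\/ Moufang (Qmul beta gamma delta),
      (beta, gamma, delta) \in unconditional_triples
    | (forall x y : gT, x * x * y = y * (x * x)) /\
      (beta, gamma, delta) \in conditional_triples].
Proof.
case=> g sg Hb Hc Hd /flexible_QmulP[_ F2 _].
rewrite !inE in Hb Hc Hd; move: Hb Hc Hd F2.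
do 3![do ?case/orP; move/eqP->] => F2.
(* At x = 1 the identity is trivial or reads star g = g: half the triples go. *)
all: have F1 := F2 1 g.
all: rewrite !ffunE /= ?(mul1g, mulg1, star1) ?starK in F1.
all: try by case: sg; move: F1; rewrite ?mulg1 => /mulgI.
all: clear F1.
all: try by constructor 2; rewrite !inE eqxx ?orbT.
all: try by constructor 1; exact: group_triple_Moufang.
all: try by constructor 1; exact: starred_triple_Moufang.
all: try (constructor 3; split; last by rewrite !inE eqxx ?orbT).
(* Once g0 is cancelled, one instance equates x x y and y x x: the first if [delta] has no star, the
   second if it has two. *)
all: try by move=> x y; move: (F2 x y) (F2 (star x) (star y));
  rewrite !ffunE /= ?starM ?starK -!mulgA => /mulgI ? /mulgI ?.
(* Only triples in which the identity forces commutativity remain; substituting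
   starred elements for x and y removes the stars that stand in the way. *)
all: have C : forall x y : gT, x * y = y * x.
all: try (move=> x y; move: (F2 x y) (F2 (star x) y);
  move: (F2 x (star y)) (F2 (star x) (star y));
  rewrite !ffunE /= ?starM ?starK -!mulgA; do 4!move/mulgI=> ?).
(* One of the four instances is x y = y x with a common factor x or x' on the left or on the
   right. *)
all: try match goal with E : _ = _ |- _ =>
  first [by apply: (mulgI x); rewrite E | by apply: (mulgI (star x)); rewrite E
        | by apply: (mulIg x); rewrite -!mulgA E
        | by apply: (mulIg (star x)); rewrite -!mulgA E] end.
all: have [w1 w2 [d1 d2 d3 d4]] := commutative_words C.
(* Unfolding the list lets the rewriting bring the triple and the list entries to the same
   representatives of the merged words. *)
all: constructor 2; rewrite /unconditional_triples -?w1 ?w2 ?d1 ?d2 ?d3 ?d4.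
all: by rewrite !inE eqxx ?orbT.
Qed.

End StarredGroup.

Theorem theorem8p9 (gT : finGroupType) (star : gT -> gT) (g0 : gT)
    (beta gamma delta : {ffun gT * gT -> gT})
    (star_anti : involutory_antiaut star)
    (star_nonid : exists g, star g <> g)
    (star_central : forall g, g * star g \in 'Z([set: gT]))
    (g0_central : g0 \in 'Z([set: gT]))
    (g0_star : star g0 = g0)
    (Hbeta : beta \in beta_words star)
    (Hgamma : gamma \in gamma_words gT)
    (Hdelta : delta \in delta_words star g0) :
  flexible (Qmul beta gamma delta) <->
  [\/ Moufang (Qmul beta gamma delta),
      (beta, gamma, delta) \in
        [:: (word (fun x y => x * y), word (fun x y => x * y),
             word (fun x y => g0 * star y * star x));
            (word (fun x y => star x * y), word (fun x y => y * x),
             word (fun x y => g0 * x * star y));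
            (word (fun x y => star x * y), word (fun x y => y * x),
             word (fun x y => g0 * star x * y));
            (word (fun x y => star x * y), word (fun x y => y * x),
             word (fun x y => g0 * star y * x));
            (word (fun x y => y * x), word (fun x y => y * x),
             word (fun x y => g0 * star x * star y));
            (word (fun x y => y * x), word (fun x y => y * x),
             word (fun x y => g0 * y * x));
            (word (fun x y => y * star x), word (fun x y => x * y),
             word (fun x y => g0 * x * star y));
            (word (fun x y => y * star x), word (fun x y => x * y),
             word (fun x y => g0 * star x * y));
            (word (fun x y => y * star x), word (fun x y => x * y),
             word (fun x y => g0 * y * star x));
            (word (fun x y => y * star x), word (fun x y => x * y),
             word (fun x y => g0 * star y * x))]
    | 2.-abelem ([set: gT] / 'Z([set: gT])) /\
      (beta, gamma, delta) \in
        [:: (word (fun x y => x * y), word (fun x y => x * y),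
             word (fun x y => g0 * star x * star y));
            (word (fun x y => x * y), word (fun x y => x * y),
             word (fun x y => g0 * y * x));
            (word (fun x y => y * x), word (fun x y => y * x),
             word (fun x y => g0 * x * y));
            (word (fun x y => y * x), word (fun x y => y * x),
             word (fun x y => g0 * star y * star x))]].
Proof.
split=> [F | [M | T | [E T]]].
- have [M | T | [sqC T]] := flexible_triples star_anti star_central g0_central
    g0_star star_nonid Hbeta Hgamma Hdelta F.
  + by constructor 1.
  + by constructor 2.
  + by constructor 3; split=> //; apply/abelem2_quotient_center.
- have [_ op1 _ _] := Qmul_loop star_anti Hbeta Hgamma Hdelta.
  exact: Moufang_flexible op1 M.
- exact: (unconditional_flexible star_anti star_central g0_central g0_star T).
- move/abelem2_quotient_center: E => sqC.
  exact: (conditional_flexible star_anti star_central g0_central sqC T).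
Qed.
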